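(* For every $\lambda\in(0,1)$, the dissipative outer billiard map $T$ about the unit square with contraction rate $\lambda$ has exactly $m=m(\lambda)$ distinct periodic orbits $\Gamma_1,\ldots,\Gamma_m$, and the period of $\Gamma_i$ is equal to $4i$. Moreover, for every non-singular $z\in X$, there exists $1\le i\le m$ such that $\operatorname{dist}(T^n(z),\Gamma_i)\to0$ as $n\to+\infty$.
   Context: Let $P\subset\mathbb{C}$ be the closed unit square with corners $w_0=0$, $w_1=-i$, $w_2=1-i$, $w_3=1$ (here $i=\sqrt{-1}$; counterclockwise order, indices mod $4$). Let $X=\mathbb{C}\setminus P$ and $A_j=\{w_j+x(w_{j-1}-w_j)+y(w_j-w_{j+1}) : x,y>0\}$, $j=0,\ldots,3$; these are disjoint open cones in $X$. For $\lambda\in(0,1)$ the dissipative outer billiard map is $T(z)=-\lambda z+(1+\lambda)w_j$ for $z\in A_j$. The singular set is $\mathcal{S}=X\setminus\bigcup_jA_j$, on which $T$ is not defined. A point $z\in X$ is non-singular if its forward orbit never meets $\mathcal{S}$. $\operatorname{dist}$ is the Euclidean distance on $\mathbb{C}$. Periodic orbits are orbits of $T$ contained in $X\setminus\mathcal{S}$, and ''period'' means minimal period. For $n\ge1$ let $\lambda_n$ be the unique root in $[0,1)$ of $x^{2n}-x^n-x^{n-1}+1$; the sequence $\{\lambda_n\}$ is strictly increasing, with $\lambda_1=0$ and limit $1$. For $\lambda\in(0,1)$, $m(\lambda)$ is the positive integer with $\lambda_{m(\lambda)}<\lambda\le\lambda_{m(\lambda)+1}$. *)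

(* Defs.v *)
From HB Require Import structures.
From mathcomp Require Import all_boot all_order all_algebra.
From mathcomp Require Import complex.
From mathcomp Require Import all_classical all_reals all_analysis.

Set Implicit Arguments.
Unset Strict Implicit.
Unset Printing Implicit Defensive.

Import Order.TTheory GRing.Theory Num.Theory.
Import numFieldNormedType.Exports.

Local Open Scope classical_set_scope.
Local Open Scope ring_scope.
Local Open Scope complex_scope.

Section OuterBilliard.
Variable R : realType.

Definition corner (j : 'I_4) : R[i] :=
  tnth [tuple 0; 0 -i* 1; 1 -i* 1; 1] j.

Definition square : set R[i] :=
  [set z | 0 <= complex.Re z <= 1 /\ -1 <= complex.Im z <= 0].

Definition exterior : set R[i] := ~` square.

(* The index arithmetic is that of the ring 'I_4, i.e. modulo 4. *)
Definition cone (j : 'I_4) : set R[i] :=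
  [set z | exists x y : R, [/\ 0 < x, 0 < y &
     z = corner j + x%:C * (corner (j - 1) - corner j)
                  + y%:C * (corner j - corner (j + 1))]].

Definition singular_set : set R[i] := exterior `\` \bigcup_j cone j.

Variable lam : R.

(* The cones are disjoint, so the index picked is unique. Outside their union,
   where the map is undefined, the value is a junk one: points whose orbits
   meet the singular set are excluded below. *)
Definition billiard (z : R[i]) : R[i] :=
  if [pick j : 'I_4 | z \in cone j] is Some j
  then - lam%:C * z + (1 + lam)%:C * corner j
  else z.

Definition orbit (z : R[i]) : set R[i] := range (fun n => iter n billiard z).

Definition nonsingular (z : R[i]) : Prop :=
  exterior z /\ orbit z `&` singular_set = set0.

Definition periodic_orbit (G : set R[i]) : Prop :=
  exists z p, [/\ (0 < p)%N, iter p billiard z = z, G = orbit z &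
                  G `<=` exterior `\` singular_set].

Definition has_period (G : set R[i]) (p : nat) : Prop :=
  forall z, G z ->
    [/\ (0 < p)%N, iter p billiard z = z &
        forall q, (0 < q < p)%N -> iter q billiard z <> z].

End OuterBilliard.

Definition dist_to (R : realType) (z : R[i]) (G : set R[i]) : R :=
  inf [set ComplexField.Normc.normc (z - a) | a in G].

Section Threshold.
Variable R : realType.

(* Meaningful for 1 <= n only, where the root exists and is unique. *)
Definition threshold (n : nat) : R :=
  xget 0 [set x | 0 <= x < 1 /\
                  root ('X^(2 * n)%N - 'X^n - 'X^(n.-1) + 1 : {poly R}) x].

Definition orbit_count (lam : R) : nat :=
  xget 0%N [set m | (0 < m)%N /\ threshold m < lam <= threshold m.+1].

End Threshold.

(* Main.v *)
Require Import Defs.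
From HB Require Import structures.
From mathcomp Require Import all_boot all_order all_algebra.
From mathcomp Require Import complex.
From mathcomp Require Import all_classical all_reals all_analysis.
From mathcomp Require Import ring lra zify.

Set Implicit Arguments.
Unset Strict Implicit.
Unset Printing Implicit Defensive.

Import Order.TTheory GRing.Theory Num.Theory.
Import numFieldNormedType.Exports.

Local Open Scope classical_set_scope.
Local Open Scope ring_scope.
Local Open Scope complex_scope.

(** Write a point of the cone A_j as [pt j x y], where x, y > 0 are its
coordinates along the two edge directions of A_j.  The rotation by a quarter
turn about the centre of the square commutes with the map T and permutes the
cones, so T has the same form in all four charts: it sends (j, x, y) to
(j + 1, 1 - lam y, lam x) if lam y < 1 (a turn), to
(j + 2, 1 + lam x, lam y - 1) if lam y > 1 (a skip), and to the singular set
if lam y = 1 ([billiard_turn], [billiard_skip], [pt_edge_singular]).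

A skip lowers y by more than 1, so every non-singular orbit makes infinitely
many turns.  Let k be the number of skips before the next turn; it is
determined by y ([level]).  With n = k + 1 and
s_n = 1 + lam + ... + lam^(n-1), the state after this turn is
(s_n - lam^n y, s_n - 1 + lam^n x) ([ret]).  Three facts determine the
dynamics.

- Just after a turn x < 1, which makes the next y less than
  s_n - 1 + lam^n <= s_n; hence the number of skips never increases from one
  turn to the next ([level_drop]).  So it is eventually a constant k
  ([eventually_stays]).

- For constant k the map [ret k] is a quarter turn about its fixed point
  composed with a contraction by lam^n.  Two returns reflect y about the
  ordinate of the fixed point, so an orbit that keeps the same k forces the
  fixed point itself to lie strictly inside the region of k skips
  ([stays_level_fixpt]).  By a direct computation this means
  lam^(2n) - lam^n - lam^(n-1) + 1 < 0 ([level_fixpt]), that is lam_n < lam,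
  that is n <= m(lam) ([le_orbit_count]).

- Conversely, for n <= m(lam) the fixed point of [ret k] generates a periodic
  orbit of T.  One return takes n steps and shifts the cone index by
  2k + 1, an odd number, so the orbit passes through the fixed point in each
  of the four cones and has period 4n.

A non-singular orbit with eventual value k visits the same cones as the
periodic orbit of index k started in the same cone; on a common cone T is
affine with linear part - lam, so the distance between the two orbits is
multiplied by lam at each step ([stays_shadow], [nonsingular_shadow]).  This
gives the convergence, and it also shows that a periodic orbit coincides with
the one that it shadows ([periodic_orbit_is_cycle]). *)

(** * Coordinates in the four cones *)

Lemma ord4_ind (P : 'I_4 -> Prop) :
  P 0 -> P 1 -> P 2%:R -> P 3%:R -> forall j, P j.
Proof.
move=> P0 P1 P2 P3 j.
have [-> //|[-> //|[-> //|-> //]]] : j = 0 \/ j = 1 \/ j = 2%:R \/ j = 3%:R.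
by case: j => [[|[|[|[|//]]]] lt_j4];
  [left|right; left|do 2 right; left|do 3 right]; apply: val_inj.
Qed.

Lemma natr4_eq0 (a : nat) : ((a%:R : 'I_4) == 0) = (4 %| a)%N.
Proof. by rewrite Zp_nat -val_eqE /= /dvdn. Qed.

Section Coordinates.
Variable R : realType.
Implicit Types (x y : R) (j : 'I_4) (z : R[i]).

Definition pt j x y : R[i] :=
  corner R j + x%:C * (corner R (j - 1) - corner R j)
             + y%:C * (corner R j - corner R (j + 1)).

Lemma ptE0 x y : pt 0 x y = x +i* y.
Proof.
rewrite /pt /corner !(tnth_nth 0) /=; apply/eqP; rewrite eq_complex /=.
by apply/andP; split; apply/eqP; ring.
Qed.

Lemma ptE1 x y : pt 1 x y = (- y) +i* (x - 1).
Proof.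
rewrite /pt /corner !(tnth_nth 0) /=; apply/eqP; rewrite eq_complex /=.
by apply/andP; split; apply/eqP; ring.
Qed.

Lemma ptE2 x y : pt 2%:R x y = (1 - x) +i* (- 1 - y).
Proof.
rewrite /pt /corner !(tnth_nth 0) /=; apply/eqP; rewrite eq_complex /=.
by apply/andP; split; apply/eqP; ring.
Qed.

Lemma ptE3 x y : pt 3%:R x y = (1 + y) +i* (- x).
Proof.
rewrite /pt /corner !(tnth_nth 0) /=; apply/eqP; rewrite eq_complex /=.
by apply/andP; split; apply/eqP; ring.
Qed.

Definition ptE := (ptE0, ptE1, ptE2, ptE3).

Lemma pt_inj j j' x y x' y' : 0 < x -> 0 < y -> 0 < x' -> 0 < y' ->
  pt j x y = pt j' x' y' -> [/\ j = j', x = x' & y = y'].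
Proof.
move=> x0 y0 x'0 y'0.
by elim/ord4_ind: j; elim/ord4_ind: j'; rewrite !ptE => -[] e1 e2;
  first [by exfalso; lra | split => //; lra].
Qed.

Lemma pt_exterior j x y : 0 < x -> 0 < y -> exterior (pt j x y).
Proof.
move=> x0 y0; elim/ord4_ind: j; rewrite ptE /exterior /square /setC /= => -[];
  by move=> /andP[? ?] /andP[? ?]; lra.
Qed.

Lemma pt_cone j x y : 0 < x -> 0 < y -> cone j (pt j x y).
Proof. by move=> x0 y0; exists x, y. Qed.

(** The half-line y = 0 bounding a cone lies on the line through a side of the
square; where x > 1 it is beyond that side, and no cone meets it.  This is
where T sends the points with lam y = 1. *)
Lemma pt_edge_singular j x : 1 < x -> singular_set (pt j x 0).
Proof.
move=> x1; split.
  elim/ord4_ind: j; rewrite ptE /exterior /square /setC /= => -[];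
  by move=> /andP[? ?] /andP[? ?]; lra.
move=> [j' _ [x' [y' [x'0 y'0]]]]; rewrite -/(pt j' x' y').
by elim/ord4_ind: j; elim/ord4_ind: j'; rewrite !ptE => -[] e1 e2; lra.
Qed.

End Coordinates.

(** * Partial sums of the geometric series *)

Section Geometric.
Variable R : realType.
Implicit Types (x y : R).

Definition geo x k : R := \sum_(i < k) x ^+ i.

Lemma geo0 x : geo x 0 = 0.
Proof. by rewrite /geo big_ord0. Qed.

Lemma geoSr x k : geo x k.+1 = geo x k + x ^+ k.
Proof. by rewrite /geo big_ord_recr. Qed.

Lemma geoS x k : geo x k.+1 = 1 + x * geo x k.
Proof.
rewrite /geo big_ord_recl expr0; congr (_ + _).
by rewrite mulr_sumr; apply: eq_bigr => i _; rewrite lift0 exprS.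
Qed.

Lemma geo_ge0 x k : 0 <= x -> 0 <= geo x k.
Proof. by move=> x0; apply: sumr_ge0 => i _; apply: exprn_ge0. Qed.

Lemma geoS_ge1 x k : 0 <= x -> 1 <= geo x k.+1.
Proof. by move=> x0; rewrite geoS lerDl mulr_ge0 // geo_ge0. Qed.

Lemma geo_factor x k : (1 - x) * geo x k = 1 - x ^+ k.
Proof. by rewrite -[RHS]opprB subrX1 -mulNr opprB. Qed.

Lemma expr_small x e : 0 < x < 1 -> 0 < e -> exists n, x ^+ n < e.
Proof.
move=> /andP[x0 x1] e0.
have xn : `|x| < 1 by rewrite gtr0_norm.
have /cvgrPdist_lt/(_ e e0)[N _ /(_ N (leqnn N))] := cvg_expr xn.
by rewrite /= sub0r normrN ger0_norm ?exprn_ge0 ?ltW // => ?; exists N.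
Qed.

End Geometric.

(** * The thresholds and the orbit count *)

Section Thresholds.
Variable R : realType.
Implicit Types (x y lam : R).

(** The value at x of the polynomial whose root in [0, 1) is lam_n, for
n >= 1. *)
Definition thr n x : R := x ^+ (2 * n) - x ^+ n - x ^+ n.-1 + 1.

(** The quotient of [thr k.+1] by 1 - x: it has the sign of [thr k.+1] on
[0, 1), but not its zero at x = 1. *)
Definition thr_cofactor k x : R := geo x k * (1 - x ^+ k.+1) - x ^+ (k.*2.+1).

Lemma thr_factor k x : thr k.+1 x = (1 - x) * thr_cofactor k x.
Proof.
rewrite /thr /thr_cofactor mulrBr mulrA geo_factor /= mul2n doubleS !exprS.
rewrite -muln2 exprM; ring.
Qed.

Lemma thr_sign k x : x < 1 -> (thr k.+1 x < 0) = (thr_cofactor k x < 0).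
Proof. by move=> x1; rewrite thr_factor pmulr_rlt0 // subr_gt0. Qed.

(** This says that geo x k / x^N is nonincreasing in x, in a form that makes
sense at x = 0. *)
Lemma geo_cross x y k N : 0 <= x -> x <= y -> (k <= N)%N ->
  x ^+ N * geo y k <= y ^+ N * geo x k.
Proof.
move=> x0 xy kN; rewrite /geo !mulr_sumr; apply: ler_sum => i _.
have iN : (i <= N)%N by apply: leq_trans kN; apply: ltnW.
rewrite -(subnK iN) !exprD -!mulrA (mulrC (y ^+ i)).
apply: ler_wpM2r; first by rewrite mulr_ge0 // exprn_ge0 // (le_trans x0).
by apply: lerXn2r => //; rewrite nnegrE // (le_trans x0).
Qed.

(** On (0, 1), the cofactor is negative exactly when
(geo x k / x^(2k+1)) * (1 - x^(k+1)) < 1, and the left-hand side is decreasing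
in x if k > 0: its first factor by [geo_cross], its second one clearly.  For
k = 0 the cofactor is - x. *)
Lemma thr_crosses_once n x y : (0 < n)%N -> 0 <= x -> x < y -> y < 1 ->
  thr n x <= 0 -> thr n y < 0.
Proof.
case: n => // k _ x0 xy y1; have x1 := lt_trans xy y1.
rewrite thr_sign // thr_factor pmulr_rle0 ?subr_gt0 // /thr_cofactor.
have y0 := le_lt_trans x0 xy.
case: k => [|k].
  by rewrite !geo0 !mul0r !sub0r double0 !expr1 oppr_lt0.
set N := k.+1.*2.+1 => hx.
have xpos : 0 < x.
  rewrite lt_neqAle x0 andbT; apply/negP => /eqP x_eq0; move: hx.
  by rewrite -x_eq0 geoS mul0r !expr0n /=; lra.
have cross : x ^+ N * geo y k.+1 <= y ^+ N * geo x k.+1.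
  by apply: geo_cross => //; [exact: ltW|rewrite /N; lia].
have gy : 0 < geo y k.+1 by apply: lt_le_trans (geoS_ge1 k (ltW y0)).
have gx : 0 < geo x k.+1 by apply: lt_le_trans (geoS_ge1 k x0).
have pows : x ^+ k.+2 < y ^+ k.+2 by rewrite ltrXn2r.
have xk : x ^+ k.+2 < 1 by rewrite exprn_ilt1.
have XN : 0 < x ^+ N by rewrite exprn_gt0.
have YN : 0 < y ^+ N by rewrite exprn_gt0.
rewrite -(pmulr_rlt0 _ XN) mulrBr mulrA subr_lt0.
apply: (@lt_le_trans _ _ (x ^+ N * geo y k.+1 * (1 - x ^+ k.+2))).
  by rewrite ltr_pM2l; [rewrite ltrD2l ltrN2|exact: mulr_gt0].
apply: (@le_trans _ _ (y ^+ N * geo x k.+1 * (1 - x ^+ k.+2))).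
  by rewrite ler_pM2r // subr_gt0.
by rewrite -mulrA mulrC ler_pM2r // -subr_le0.
Qed.

(** The cofactor is nonnegative at 0 and equals -1 at 1, so the intermediate
value theorem gives it a root below 1; applied to [thr] itself, it could
return the root 1. *)
Lemma thr_root_exists k : exists2 x : R, 0 <= x < 1 & thr k.+1 x = 0.
Proof.
pose q : {poly R} := 'X^(k.*2.+1) - (\sum_(i < k) 'X^i) * (1 - 'X^(k.+1)).
have qE x : q.[x] = - thr_cofactor k x.
  rewrite /q /thr_cofactor /geo !hornerE horner_sum.
  by under eq_bigr do rewrite hornerXn; rewrite opprB.
have q0 : q.[0] <= 0.
  rewrite qE /thr_cofactor !expr0n /= !subr0 mulr1 oppr_le0.
  exact: geo_ge0.
have q1 : q.[1] = 1 by rewrite qE /thr_cofactor !expr1n subrr mulr0 sub0r opprK.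
have [|r /andP[r0 r1] /rootP rr] := @poly_ivt R q 0 1 ler01.
  by rewrite q0 q1 ler01.
exists r; last first.
  by rewrite thr_factor -[thr_cofactor _ _]opprK -qE rr oppr0 mulr0.
rewrite r0 lt_neqAle r1 andbT; apply/negP => /eqP r_eq1.
by move/eqP: rr; rewrite r_eq1 q1 oner_eq0.
Qed.

Lemma root_thr n x :
  root ('X^(2 * n)%N - 'X^n - 'X^(n.-1) + 1 : {poly R}) x = (thr n x == 0).
Proof. by rewrite /root !hornerE. Qed.

Lemma threshold_root n : (0 < n)%N ->
  0 <= threshold R n < 1 /\ thr n (threshold R n) = 0.
Proof.
case: n => // k _; have [r r01 /eqP rr] := thr_root_exists k.
have := @xgetPex _ 0 [set x : R | 0 <= x < 1 /\
  root ('X^(2 * k.+1)%N - 'X^(k.+1) - 'X^(k.+1.-1) + 1 : {poly R}) x].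
rewrite -/(threshold R k.+1) => /(_ _)[|t01].
  by exists r; rewrite /= root_thr.
by rewrite root_thr => /eqP.
Qed.

Lemma threshold_lt n lam : (0 < n)%N -> 0 < lam < 1 ->
  (threshold R n < lam) = (thr n lam < 0).
Proof.
move=> n0 /andP[l0 l1]; have [/andP[t0 t1] tr] := threshold_root n0.
apply/idP/idP => [tl|pl].
  by apply: (thr_crosses_once n0 t0 tl l1); rewrite tr.
rewrite ltNge; apply/negP; rewrite le_eqVlt => /orP[/eqP le|lt].
  by move: pl; rewrite le tr ltxx.
by have := thr_crosses_once n0 (ltW l0) lt t1 (ltW pl); rewrite tr ltxx.
Qed.

(** For fixed lam in (0, 1) the cofactor is nondecreasing in its index, since
[geo] grows and the powers of lam that are subtracted shrink. *)
Lemma thr_lt0_down m n lam : 0 < lam < 1 -> (0 < m <= n)%N ->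
  thr n lam < 0 -> thr m lam < 0.
Proof.
move=> /andP[l0 l1] /andP[m0 mn]; case: m n m0 mn => // m [//|n] _.
rewrite ltnS !thr_sign // => mn; apply: le_lt_trans.
rewrite /thr_cofactor lerB //.
  apply: ler_pM; first exact/geo_ge0/ltW.
  - by rewrite subr_ge0 exprn_ile1 // ltW.
  - rewrite -(subnK mn); elim: (n - m)%N => // d /le_trans; apply.
    by rewrite addSn geoSr lerDl exprn_ge0 // ltW.
  - by rewrite lerB // ler_wiXn2l ?ltW.
by rewrite ler_wiXn2l ?ltW //; lia.
Qed.

Lemma thr_eventually_ge0 lam : 0 < lam < 1 -> exists k, 0 <= thr k.+1 lam.
Proof.
move=> hl; have /andP[l0 l1] := hl.
have [|k hk] := expr_small (e := 2^-1) hl; first by rewrite invr_gt0.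
exists k; rewrite /thr /=.
have p0 : 0 < lam ^+ (2 * k.+1) by rewrite exprn_gt0.
have pk : lam ^+ k.+1 <= lam ^+ k by rewrite ler_wiXn2l ?ltW.
lra.
Qed.

(** The indices n >= 1 with [thr n lam < 0] form an initial segment, by
[thr_lt0_down]; it contains 1 and is finite, by [thr_eventually_ge0].  Its
last element is the only possible value of m(lam). *)
Lemma le_orbit_count n lam : 0 < lam < 1 -> (0 < n)%N ->
  (n <= orbit_count lam)%N = (thr n lam < 0).
Proof.
move=> hl n0; have /andP[l0 l1] := hl.
have [M0 Mlt Mge] : [/\ (0 < orbit_count lam)%N,
    thr (orbit_count lam) lam < 0 & 0 <= thr (orbit_count lam).+1 lam].
  have := @xgetPex _ 0%N [set m | (0 < m)%N /\
    threshold R m < lam <= threshold R m.+1].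
  rewrite -/(orbit_count lam) => /(_ _)[|M0 /andP[]].
    case: (ex_minnP (thr_eventually_ge0 hl)) => -[|m] hm mmin.
      by exfalso; move: hm; rewrite thr_factor /thr_cofactor geo0; nra.
    exists m.+1; split=> //.
    rewrite threshold_lt // leNgt threshold_lt // -leNgt hm.
    by rewrite andbT ltNge; apply/negP => /mmin; rewrite ltnn.
  by rewrite threshold_lt // leNgt threshold_lt // -leNgt.
apply/idP/idP => [nM|]; first by apply: (thr_lt0_down hl _ Mlt); rewrite n0.
apply: contraTT; rewrite -ltnNge -leNgt => Mn.
rewrite leNgt; apply/negP => /(thr_lt0_down hl (m := (orbit_count lam).+1)).
by move=> /(_ Mn); rewrite ltNge Mge.
Qed.

End Thresholds.

(** * The map in coordinates *)

Section Dynamics.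
Variables (R : realType) (lam : R).
Hypothesis hlam : 0 < lam < 1.
Implicit Types (x y : R) (j : 'I_4) (z : R[i]) (u v : R * R).

Let lam_gt0 : 0 < lam. Proof. by case/andP: hlam. Qed.
Let lam_lt1 : lam < 1. Proof. by case/andP: hlam. Qed.
Let expl_gt0 n : 0 < lam ^+ n. Proof. exact: exprn_gt0. Qed.
Let geol_ge0 n : 0 <= geo lam n. Proof. exact/geo_ge0/ltW. Qed.

Local Notation T := (billiard lam).
Local Notation s := (geo lam).

Lemma billiard_pt j x y : 0 < x -> 0 < y ->
  T (pt j x y) = - lam%:C * pt j x y + (1 + lam)%:C * corner R j.
Proof.
move=> x0 y0; rewrite /billiard; case: pickP => [j'|/(_ j)].
  rewrite inE => -[x' [y' [x'0 y'0]]]; rewrite -/(pt j' x' y').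
  by move=> /pt_inj[] // <-.
by rewrite mem_set //; exact: pt_cone.
Qed.

Lemma pt_corner j : corner R j = pt j 0 0.
Proof. by rewrite /pt !mul0r !addr0. Qed.

Lemma ord4_add1 : ((0 + 1 = 1 :> 'I_4)%R * (1 + 1 = 2%:R :> 'I_4)%R *
  (2%:R + 1 = 3%:R :> 'I_4)%R * (3%:R + 1 = 0 :> 'I_4)%R)%type.
Proof. by do !split; apply: val_inj. Qed.

Lemma ord4_add2 : ((0 + 2%:R = 2%:R :> 'I_4)%R * (1 + 2%:R = 3%:R :> 'I_4)%R *
  (2%:R + 2%:R = 0 :> 'I_4)%R * (3%:R + 2%:R = 1 :> 'I_4)%R)%type.
Proof. by do !split; apply: val_inj. Qed.

(** This formula and that of [billiard_skip] describe the same image point,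
in the charts of the two cones that may contain it; the sign of lam y - 1
tells in which one the coordinates are positive. *)
Lemma billiard_turn j x y : 0 < x -> 0 < y ->
  T (pt j x y) = pt (j + 1) (1 - lam * y) (lam * x).
Proof.
move=> x0 y0; rewrite billiard_pt // pt_corner.
by elim/ord4_ind: j; rewrite ord4_add1 !ptE; apply/eqP;
  rewrite eq_complex /=; apply/andP; split; apply/eqP; ring.
Qed.

Lemma billiard_skip j x y : 0 < x -> 0 < y ->
  T (pt j x y) = pt (j + 2%:R) (1 + lam * x) (lam * y - 1).
Proof.
move=> x0 y0; rewrite billiard_pt // pt_corner.
by elim/ord4_ind: j; rewrite ord4_add2 !ptE; apply/eqP;
  rewrite eq_complex /=; apply/andP; split; apply/eqP; ring.
Qed.

Lemma billiard_contract j x y x' y' : 0 < x -> 0 < y -> 0 < x' -> 0 < y' ->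
  T (pt j x y) - T (pt j x' y') = - lam%:C * (pt j x y - pt j x' y').
Proof. by move=> *; rewrite !billiard_pt //; ring. Qed.

Lemma nonsingular_notin z n : nonsingular lam z -> ~ singular_set (iter n T z).
Proof.
move=> [_ os] sz.
suff : (Defs.orbit lam z `&` @singular_set R) (iter n T z) by rewrite os.
by split=> //; exists n.
Qed.

Lemma nonsingular_pt z : nonsingular lam z ->
  exists j x y, [/\ 0 < x, 0 < y & z = pt j x y].
Proof.
move=> nz; have := @nonsingular_notin z 0 nz; move: nz => [ez _] /= sz.
have [j _ [x [y [x0 y0 zE]]]] : (\bigcup_j @cone R j) z.
  by apply: contrapT => cz; apply: sz.
by exists j, x, y.
Qed.

Lemma nonsingular_neq1 j x y : 0 < x -> 0 < y -> nonsingular lam (pt j x y) ->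
  lam * y != 1.
Proof.
move=> x0 y0 nz; apply/negP => /eqP ly1.
apply: (@nonsingular_notin _ 1 nz); rewrite /= billiard_skip // ly1 subrr.
by apply: pt_edge_singular; rewrite ltrDl mulr_gt0.
Qed.

Lemma nonsingular_step z : nonsingular lam z -> nonsingular lam (T z).
Proof.
move=> nz; split; last first.
  apply/seteqP; split=> // w [[n _ <-]]; rewrite -iterSr.
  exact: nonsingular_notin.
have [j [x [y [x0 y0 zE]]]] := nonsingular_pt nz; rewrite zE in nz *.
have ly1 := nonsingular_neq1 x0 y0 nz.
have [ly|ly|ly] := ltgtP (lam * y) 1; last by rewrite ly eqxx in ly1.
  by rewrite billiard_turn //; apply: pt_exterior; rewrite ?mulr_gt0 ?subr_gt0.
by rewrite billiard_skip //; apply: pt_exterior;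
  rewrite ?subr_gt0 ?addr_gt0 ?mulr_gt0.
Qed.

Lemma nonsingular_iter z n : nonsingular lam z -> nonsingular lam (iter n T z).
Proof. by move=> nz; elim: n => // n; exact: nonsingular_step. Qed.

(** * Returns after each turn *)

(** The ordinates from which exactly k skips precede the next turn.  In the
form (s_k / lam^k, s_(k+1) / lam^(k+1)) these intervals are consecutive. *)
Definition level k y := (s k < lam ^+ k * y) && (lam ^+ k.+1 * y < s k.+1).

(** The bounds s_k / lam^k increase with k. *)
Lemma skip_mono k r y : (r <= k)%N -> s k < lam ^+ k * y -> s r < lam ^+ r * y.
Proof.
move=> rk; rewrite -(subnK rk); elim: (k - r)%N => // d IH.
rewrite addSn => h; apply: IH; rewrite -(ltr_pM2l lam_gt0) mulrA -exprS.
by apply: le_lt_trans h; rewrite geoS lerDr.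
Qed.

Lemma iter_skip j x y k r : 0 < x -> s k < lam ^+ k * y -> (r <= k)%N ->
  [/\ iter r T (pt j x y) =
        pt (j + r.*2%:R) (lam ^+ r * x + s r) (lam ^+ r * y - s r),
      0 < lam ^+ r * x + s r & 0 < lam ^+ r * y - s r].
Proof.
move=> x0 yk; elim: r => [|r IH] rk.
  rewrite geo0 addr0 subr0 addr0 !expr0 !mul1r; split=> //.
  by move: (skip_mono rk yk); rewrite geo0 expr0 mul1r.
have [e xr yr] := IH (ltnW rk); split.
- rewrite iterS e billiard_skip // -addrA -natrD addn2 -doubleS geoS !exprS.
  by congr (pt _ _ _); ring.
- rewrite addr_gt0 // ?mulr_gt0 //.
  by rewrite (lt_le_trans _ (geoS_ge1 r (ltW lam_gt0))).
- by rewrite subr_gt0; exact: skip_mono yk.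
Qed.

Definition ret k u : R * R :=
  (s k.+1 - lam ^+ k.+1 * u.2, s k.+1 - 1 + lam ^+ k.+1 * u.1).

Lemma iter_ret j u k : 0 < u.1 -> level k u.2 ->
  iter k.+1 T (pt j u.1 u.2) =
    pt (j + k.*2.+1%:R) (ret k u).1 (ret k u).2.
Proof.
move=> x0 /andP[ly _]; have [e xr yr] := iter_skip j x0 ly (leqnn k).
rewrite iterS e billiard_turn // -addrA natr1 /ret /= geoS !exprS.
by congr (pt _ _ _); ring.
Qed.

Lemma ret_bounds k u : 0 < u.1 -> level k u.2 ->
  [/\ 0 < (ret k u).1, (ret k u).1 < 1 & 0 < (ret k u).2].
Proof.
move=> x0 /andP[ly uy]; rewrite /ret /=; split; first by rewrite subr_gt0.
  rewrite geoS exprS -mulrA; move: (ltr_pM2l lam_gt0 (s k) (lam ^+ k * u.2)).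
  by rewrite ly; lra.
by rewrite ltr_wpDl ?mulr_gt0 // subr_ge0 geoS_ge1 // ltW.
Qed.

(** The least n with lam^n y <= s_n is positive, and k = n - 1 is the number of
skips; equality is excluded because after k skips it would put the orbit at
lam y = 1. *)
Lemma level_exists j x y : 0 < x -> 0 < y -> nonsingular lam (pt j x y) ->
  exists k, level k y.
Proof.
move=> x0 y0 nz.
have ex : exists n, lam ^+ n * y <= s n.
  have [|n hn] := expr_small (e := y^-1) hlam; first by rewrite invr_gt0.
  exists n.+1; apply: le_trans (geoS_ge1 n (ltW lam_gt0)).
  rewrite -ler_pdivlMr // mul1r; apply: le_trans (ltW hn).
  by rewrite exprS ger_pMl // ltW.
case: (ex_minnP ex) => -[|k] hk kmin.
  by move: hk; rewrite geo0 expr0 mul1r leNgt y0.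
have ly : s k < lam ^+ k * y.
  by rewrite ltNge; apply/negP => /kmin; rewrite ltnn.
exists k; rewrite /level ly lt_neqAle hk andbT.
have [e xr yr] := iter_skip j x0 ly (leqnn k).
have nk := nonsingular_iter k nz; rewrite e in nk.
apply: contra (nonsingular_neq1 xr yr nk); rewrite geoS exprS => /eqP h.
by apply/eqP; rewrite mulrBr mulrA h; ring.
Qed.

(** The new ordinate s_n - 1 + lam^n x, with n = k + 1, is at most s_n as
x < 1, whereas n skips in a row need an ordinate above s_n / lam^n. *)
Lemma level_drop k k' u : 0 < u.1 -> u.1 < 1 -> level k u.2 ->
  level k' (ret k u).2 -> (k' <= k)%N.
Proof.
move=> x0 x1 ly /andP[ly' _]; rewrite leqNgt; apply/negP => kk'.
have := skip_mono kk' ly'; rewrite /ret /=; apply/negP; rewrite -leNgt.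
have sk : 0 <= s k.+1 by [].
have bound : s k.+1 - 1 + lam ^+ k.+1 * u.1 <= s k.+1.
  have : lam ^+ k.+1 * u.1 <= 1.
    by rewrite mulr_ile1 ?exprn_ile1 // ?ltW.
  lra.
apply: le_trans (ler_wpM2l (ltW (expl_gt0 k.+1)) bound) _.
by rewrite ler_piMl // exprn_ile1 // ltW.
Qed.

(** Formulated with the iterates of [ret k] rather than with the orbit under T,
so that it applies at once to the fixed point of [ret k] and does not depend
on the cone index. *)
Definition stays k u := 0 < u.1 /\ forall q, level k (iter q (ret k) u).2.

Lemma stays_pos k u q : stays k u -> 0 < (iter q (ret k) u).1.
Proof.
by move=> [u0 hl]; elim: q => // q IH; case: (ret_bounds IH (hl q)).
Qed.

Lemma iter_rets j u k q : stays k u ->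
  iter (q * k.+1) T (pt j u.1 u.2) =
    pt (j + (q * k.*2.+1)%:R) (iter q (ret k) u).1 (iter q (ret k) u).2.
Proof.
move=> st; elim: q => [|q IH]; first by rewrite !mul0n addr0.
rewrite mulSn iterD IH iter_ret; [|exact: stays_pos|exact: st.2].
by rewrite -addrA -natrD mulSn addnC.
Qed.

Lemma iter_stays j u k q r : stays k u -> (r <= k)%N ->
  let v := iter q (ret k) u in
  [/\ iter (q * k.+1 + r) T (pt j u.1 u.2) =
        pt (j + (q * k.*2.+1 + r.*2)%:R)
           (lam ^+ r * v.1 + s r) (lam ^+ r * v.2 - s r),
      0 < lam ^+ r * v.1 + s r & 0 < lam ^+ r * v.2 - s r].
Proof.
move=> st rk v; have /andP[ly _] := st.2 q.
have [e xr yr] := iter_skip (j + (q * k.*2.+1)%:R) (stays_pos q st) ly rk.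
by split=> //; rewrite addnC iterD iter_rets // e -addrA -natrD.
Qed.

(** At every time both points lie in the same cone, because by [iter_stays] the
cone index depends only on j, k and the time; there T is affine with linear
part - lam. *)
Lemma stays_shadow j u v k t : stays k u -> stays k v ->
  iter t T (pt j u.1 u.2) - iter t T (pt j v.1 v.2)
    = (- lam%:C) ^+ t * (pt j u.1 u.2 - pt j v.1 v.2).
Proof.
move=> su sv; elim: t => [|t IH]; first by rewrite expr0 mul1r.
rewrite exprS -mulrA -IH !iterS.
have rk : (t %% k.+1 <= k)%N by rewrite -ltnS ltn_mod.
rewrite (divn_eq t k.+1).
have [-> ? ?] := iter_stays j (t %/ k.+1) su rk.
have [-> ? ?] := iter_stays j (t %/ k.+1) sv rk.
exact: billiard_contract.
Qed.

(** Strong induction on the number of skips: either every return keeps it equal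
to k, or some return makes it smaller, by [level_drop], and the induction
hypothesis applies from that moment on. *)
Lemma eventually_stays j x y k : 0 < x -> x < 1 -> 0 < y -> level k y ->
  nonsingular lam (pt j x y) ->
  exists t j' u k', iter t T (pt j x y) = pt j' u.1 u.2 /\ stays k' u.
Proof.
elim/ltn_ind: k j x y => k IH j x y x0 x1 y0 ly nz; apply: contrapT => no.
apply: (no); exists 0%N, j, (x, y), k; split=> //; split=> // q.
suff [t [j' [/= e [? ? ? ?]]]] : exists t j', let v := iter q (ret k) (x, y) in
  iter t T (pt j x y) = pt j' v.1 v.2 /\
  [/\ 0 < v.1, v.1 < 1, 0 < v.2 & level k v.2].
  by [].
elim: q => [|q [t [j' [/= e [v0 v1 w0 lv]]]]]; first by exists 0%N, j.
set v := iter q (ret k) (x, y) in e v0 v1 w0 lv *.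
have [v'0 v'1 w'0] := ret_bounds v0 lv.
have e' : iter (k.+1 + t) T (pt j x y) =
    pt (j' + k.*2.+1%:R) (ret k v).1 (ret k v).2 by rewrite iterD e iter_ret.
have nz' := nonsingular_iter (k.+1 + t) nz; rewrite e' in nz'.
have [k' lv'] := level_exists v'0 w'0 nz'.
exists (k.+1 + t)%N, (j' + k.*2.+1%:R); split=> //; split=> //.
have := level_drop v0 v1 lv lv'.
rewrite leq_eqVlt => /orP[/eqP kk|k'k]; first by rewrite kk in lv'.
have [t' [j2 [w [k2 [e2 st]]]]] := IH k' k'k _ _ _ v'0 v'1 w'0 lv' nz'.
by case: no; exists (t' + (k.+1 + t))%N, j2, w, k2; rewrite iterD e' e2.
Qed.

(** * Fixed points of the return maps *)

Definition fix_den k : R := 1 + (lam ^+ k.+1) ^+ 2.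
Definition fixpt k : R * R :=
  ((s k.+1 - lam ^+ k.+1 * (s k.+1 - 1)) / fix_den k,
   (s k.+1 - 1 + lam ^+ k.+1 * s k.+1) / fix_den k).

Let fix_den_gt0 k : 0 < fix_den k.
Proof. by rewrite /fix_den ltr_wpDr // exprn_ge0 // ltW. Qed.

Lemma ret_fixpt k : ret k (fixpt k) = fixpt k.
Proof.
have D0 : fix_den k != 0 by rewrite gt_eqF.
have DE : fix_den k = 1 + (lam ^+ k.+1) ^+ 2 by [].
rewrite /ret /fixpt /=.
move: (lam ^+ k.+1) (s k.+1) (fix_den k) D0 DE => a c D D0 DE.
congr pair; apply: (mulIf D0); rewrite mulfVK //.
  rewrite mulrBl mulrA mulfVK // DE; ring.
rewrite mulrDl -mulrA mulfVK // DE; ring.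
Qed.

(** The upper bound in [level] always holds.  The lower bound, multiplied out,
is the negativity of [thr_cofactor]. *)
Lemma level_fixpt k : level k (fixpt k).2 = (thr k.+1 lam < 0).
Proof.
have D0 := fix_den_gt0 k.
have upper : lam ^+ k.+1 * (fixpt k).2 < s k.+1.
  rewrite /fixpt /= mulrA ltr_pdivrMr // /fix_den.
  have a0 := expl_gt0 k.+1.
  have a1 : lam ^+ k.+1 < 1 by rewrite exprn_ilt1 // ltW.
  have s1 := geoS_ge1 k (ltW lam_gt0).
  move: (lam ^+ k.+1) (s k.+1) a0 a1 s1 => a c a0 a1 s1; nra.
rewrite /level upper andbT /fixpt /= mulrA ltr_pdivlMr // /fix_den.
rewrite thr_sign // /thr_cofactor -subr_lt0.
set L := (X in X < 0); set Q := (X in _ = (X < 0)).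
suff -> : L = Q by [].
rewrite {}/L {}/Q.
(* Every power of lam in the identity is a monomial in lam and lam ^+ k. *)
have bE : lam ^+ k = 1 - (1 - lam) * s k by rewrite geo_factor; ring.
by rewrite !exprS -muln2 exprM bE geoS; ring.
Qed.

Lemma iter_ret_fixpt k q : iter q (ret k) (fixpt k) = fixpt k.
Proof. by elim: q => //= q ->; exact: ret_fixpt. Qed.

(** Two returns map the ordinate y to its reflection about that of the fixed
point, scaled by lam^(2n), with n = k + 1.  So the fixed ordinate lies between
those at times 0 and 2, both of which are at level k; the inequalities stay
strict, which matters when lam is itself a threshold. *)
Lemma stays_level_fixpt k u : stays k u -> level k (fixpt k).2.
Proof.
move=> [_ lu]; have /andP[ly0 uy0] := lu 0%N; have /andP[ly2 uy2] := lu 2%N.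
have half_turn : (iter 2 (ret k) u).2 - (fixpt k).2
    = - (lam ^+ k.+1) ^+ 2 * (u.2 - (fixpt k).2).
  rewrite -{1}(ret_fixpt k) -{1}(ret_fixpt k) /ret /=; ring.
have a2 : 0 < (lam ^+ k.+1) ^+ 2 by rewrite exprn_gt0.
have [y_le|y_gt] := leP u.2 (fixpt k).2.
  have y2_ge : (fixpt k).2 <= (iter 2 (ret k) u).2.
    by rewrite -subr_ge0 half_turn mulNr oppr_ge0 pmulr_rle0 // subr_le0.
  apply/andP; split.
    by apply: lt_le_trans ly0 _; rewrite ler_pM2l.
  by apply: le_lt_trans uy2; rewrite ler_pM2l.
have y2_lt : (iter 2 (ret k) u).2 < (fixpt k).2.
  by rewrite -subr_lt0 half_turn mulNr oppr_lt0 mulr_gt0 // subr_gt0.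
apply/andP; split.
  by apply: lt_trans ly2 _; rewrite ltr_pM2l.
by apply: lt_trans uy0; rewrite ltr_pM2l.
Qed.

Lemma fixpt_stays k : thr k.+1 lam < 0 -> stays k (fixpt k).
Proof.
rewrite -level_fixpt => lf; split=> [|q]; last by rewrite iter_ret_fixpt.
by rewrite -(ret_fixpt k) /ret /= subr_gt0; case/andP: lf.
Qed.

(** * The periodic orbits *)

Definition cycle_pt j k : R[i] := pt j (fixpt k).1 (fixpt k).2.
Definition cycle_orbit k : set R[i] := Defs.orbit lam (cycle_pt 0 k).

Section Cycle.
Variable k : nat.
Hypothesis thr_k : thr k.+1 lam < 0.

Let fix_st : stays k (fixpt k) := fixpt_stays thr_k.

Lemma iter_cycle_pt j q r : (r <= k)%N ->
  [/\ iter (q * k.+1 + r) T (cycle_pt j k) =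
        pt (j + (q * k.*2.+1 + r.*2)%:R)
           (lam ^+ r * (fixpt k).1 + s r) (lam ^+ r * (fixpt k).2 - s r),
      0 < lam ^+ r * (fixpt k).1 + s r & 0 < lam ^+ r * (fixpt k).2 - s r].
Proof.
by move=> rk; have := iter_stays j q fix_st rk; rewrite /= iter_ret_fixpt.
Qed.

Lemma iter_cycle_rets j q :
  iter (q * k.+1) T (cycle_pt j k) = cycle_pt (j + (q * k.*2.+1)%:R) k.
Proof. by rewrite /cycle_pt iter_rets // iter_ret_fixpt. Qed.

Lemma cycle_period m j : iter (m * (4 * k.+1)) T (cycle_pt j k) = cycle_pt j k.
Proof.
rewrite mulnA iter_cycle_rets (_ : (_ * _)%:R = 0) ?addr0 //.
by apply/eqP; rewrite natr4_eq0 -mulnA dvdn_mull // dvdn_mulr.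
Qed.

Lemma cycle_pt_pos : 0 < (fixpt k).1 /\ 0 < (fixpt k).2.
Proof.
have [_] := iter_cycle_pt 0 0 (leq0n k).
by rewrite expr0 !mul1r geo0 addr0 subr0.
Qed.

(** A return of the ordinate to its value forces a whole number of returns,
since skips lower it; a return of the cone index then forces that number to be
a multiple of 4, since each return adds the odd number 2k + 1 to the index. *)
Lemma cycle_period_min q : (0 < q)%N ->
  iter q T (cycle_pt 0 k) = cycle_pt 0 k -> (4 * k.+1 <= q)%N.
Proof.
move=> q0; have [f1 f2] := cycle_pt_pos.
have rk : (q %% k.+1 <= k)%N by rewrite -ltnS ltn_mod.
rewrite {1}(divn_eq q k.+1); have [-> xr yr] := iter_cycle_pt 0 (q %/ k.+1) rk.
move=> /(pt_inj xr yr f1 f2)[]; rewrite add0r => jE _ yE.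
have r0 : (q %% k.+1 = 0)%N.
  apply/eqP; rewrite -leqn0 leqNgt; apply/negP => rpos.
  have : lam ^+ (q %% k.+1) * (fixpt k).2 < (fixpt k).2.
    by rewrite gtr_pMl // exprn_ilt1 ?ltW // -lt0n.
  by have := geol_ge0 (q %% k.+1); lra.
move/eqP: jE; rewrite r0 addn0 natr4_eq0 Gauss_dvdl; last first.
  by rewrite (@coprime_pexpl 2 2) // coprime2n /= odd_double.
move=> /dvdn_leq h; rewrite (divn_eq q k.+1) r0 addn0 leq_pmul2r // h //.
by rewrite divn_gt0 // dvdn_leq // /dvdn r0.
Qed.

(** An odd number is its own inverse modulo 4, so j (2k + 1) returns shift the
cone index by j. *)
Lemma cycle_pt_in_orbit j : cycle_orbit k (cycle_pt j k).
Proof.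
exists (j * k.*2.+1 * k.+1)%N => //.
rewrite iter_cycle_rets add0r; congr cycle_pt.
apply: val_inj; rewrite Zp_nat /= -{2}(modn_small (ltn_ord j)).
have -> : (j * k.*2.+1 * k.*2.+1 = (j * (k * k.+1)) * 4 + j)%N by lia.
by rewrite modnMDl.
Qed.

Lemma cycle_orbit_regular : cycle_orbit k `<=` @exterior R `\` @singular_set R.
Proof.
move=> _ [n _ <-]; have rk : (n %% k.+1 <= k)%N by rewrite -ltnS ltn_mod.
rewrite (divn_eq n k.+1); have [-> xr yr] := iter_cycle_pt 0 (n %/ k.+1) rk.
split; first exact: pt_exterior.
move=> [_]; apply; exists (0 + (n %/ k.+1 * k.*2.+1 + (n %% k.+1).*2)%:R) => //.
exact: pt_cone.
Qed.

Lemma cycle_orbit_periodic : periodic_orbit lam (cycle_orbit k).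
Proof.
exists (cycle_pt 0 k), (4 * k.+1)%N; split=> //.
  by rewrite -[X in iter X]mul1n cycle_period.
exact: cycle_orbit_regular.
Qed.

Lemma cycle_orbit_period : has_period lam (cycle_orbit k) (4 * k.+1).
Proof.
have per := cycle_period 1 0; rewrite mul1n in per.
move=> _ [n _ <-]; split=> // [|q /andP[q0 qlt] e].
  by rewrite -iterD addnC iterD per.
suff /(cycle_period_min q0) : iter q T (cycle_pt 0 k) = cycle_pt 0 k.
  by rewrite leqNgt qlt.
(* Push the coincidence on to the next return to the starting point. *)
have nle : (n <= n * (4 * k.+1))%N by rewrite leq_pmulr.
rewrite -{1}(cycle_period n 0) -iterD addnC -(subnK nle) -addnA iterD addnC.
by rewrite iterD e -iterD subnK // cycle_period.
Qed.

End Cycle.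

(** * Convergence *)

(** One return first brings x below 1, as [eventually_stays] requires. *)
Lemma nonsingular_shadow z : nonsingular lam z ->
  exists k N j, thr k.+1 lam < 0 /\
    forall t, iter (t + N) T z - iter t T (cycle_pt j k)
      = (- lam%:C) ^+ t * (iter N T z - cycle_pt j k).
Proof.
move=> nz; have [j [x [y [x0 y0 zE]]]] := nonsingular_pt nz.
rewrite zE in nz *; have [k ly] := level_exists x0 y0 nz.
have [x'0 x'1 y'0] := @ret_bounds k (x, y) x0 ly.
have e := @iter_ret j (x, y) k x0 ly; rewrite [X in iter _ _ X]/= in e.
have nz' := nonsingular_iter k.+1 nz; rewrite e in nz'.
have [k' ly'] := level_exists x'0 y'0 nz'.
have [t [j' [u [k2 [e' st]]]]] := eventually_stays x'0 x'1 y'0 ly' nz'.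
have lf := stays_level_fixpt st; rewrite level_fixpt in lf.
exists k2, (t + k.+1)%N, j'; split=> // n.
rewrite iterD (iterD t k.+1) e e'.
exact: stays_shadow st (fixpt_stays lf).
Qed.

Lemma normc_shadow t (w : R[i]) :
  ComplexField.Normc.normc ((- lam%:C) ^+ t * w)
    = lam ^+ t * ComplexField.Normc.normc w.
Proof.
elim: t => [|t IH]; first by rewrite !expr0 !mul1r.
rewrite !exprS -!mulrA ComplexField.Normc.normcM IH; congr (_ * _).
by rewrite /= oppr0 expr0n /= addr0 sqrrN sqrtr_sqr gtr0_norm.
Qed.

Lemma dist_to_le (w a : R[i]) (G : set R[i]) : G a ->
  0 <= dist_to w G <= ComplexField.Normc.normc (w - a).
Proof.
move=> Ga; have lb : lbound [set ComplexField.Normc.normc (w - b) | b in G] 0.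
  by move=> _ [b _ <-]; case: (w - b) => *; exact: sqrtr_ge0.
apply/andP; split.
  by apply: lb_le_inf => //; exists (ComplexField.Normc.normc (w - a)), a.
by apply: ge_inf; [exists 0|exists a].
Qed.

Lemma shadow_dist_cvg z k N j : thr k.+1 lam < 0 ->
  (forall t, iter (t + N) T z - iter t T (cycle_pt j k)
      = (- lam%:C) ^+ t * (iter N T z - cycle_pt j k)) ->
  (fun n => dist_to (iter n T z) (cycle_orbit k)) @ \oo --> (0 : R).
Proof.
move=> lk sh; rewrite -(cvg_shiftn N).
set C := ComplexField.Normc.normc (iter N T z - cycle_pt j k).
apply: (@squeeze_cvgr _ _ _ _ (fun=> 0) (fun n => lam ^+ n * C)).
- apply: nearW => n /=.
  have [m _ mE] := cycle_pt_in_orbit lk j.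
  have : cycle_orbit k (iter n T (cycle_pt j k)).
    by exists (n + m)%N => //; rewrite iterD mE.
  by move=> /(dist_to_le (iter (n + N) T z)); rewrite sh normc_shadow.
- exact: cvg_cst.
- rewrite -[X in _ --> X](mul0r C); apply: cvgM; last exact: cvg_cst.
  by apply: cvg_expr; rewrite gtr0_norm.
Qed.

Lemma iter_mul_fixed z p m : iter p T z = z -> iter (m * p) T z = z.
Proof. by move=> e; elim: m => // m IH; rewrite mulSn iterD IH. Qed.

Lemma orbit_iter z p n : (0 < p)%N -> iter p T z = z ->
  Defs.orbit lam (iter n T z) = Defs.orbit lam z.
Proof.
move=> p0 e; apply/seteqP; split=> _ [m _ <-].
  by exists (m + n)%N => //; rewrite iterD.
have nle : (n <= n * p)%N by rewrite leq_pmulr.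
exists (m + (n * p - n))%N => //.
by rewrite -iterD -addnA subnK // iterD iter_mul_fixed.
Qed.

(** Take a time t > 0 that is a multiple of both periods: the distance from the
periodic point to the cycle point that it shadows is then equal to lam^t times
itself, hence zero. *)
Lemma periodic_orbit_is_cycle G : periodic_orbit lam G ->
  exists2 k, thr k.+1 lam < 0 & G = cycle_orbit k.
Proof.
move=> [z [p [p0 zp -> reg]]].
have nz : nonsingular lam z.
  split; first by case: (reg z) => //; exists 0%N.
  by apply/seteqP; split=> // w [/reg[]].
have [k [N [j [lk sh]]]] := nonsingular_shadow nz; exists k => //.
pose t := (p * (4 * k.+1))%N.
have tz : iter (t + N) T z = iter N T z.
  by rewrite addnC iterD /t mulnC iter_mul_fixed.
have t0 : (0 < t)%N by rewrite muln_gt0 p0.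
have := congr1 (@ComplexField.Normc.normc R) (sh t).
rewrite tz cycle_period // normc_shadow => normE.
have wE : iter N T z = cycle_pt j k.
  apply/eqP; rewrite -subr_eq0; apply/eqP/ComplexField.Normc.eq0_normc.
  have lt1 : lam ^+ t < 1 by rewrite exprn_ilt1 ?ltW // -lt0n.
  move: normE; set c := ComplexField.Normc.normc _.
  by move: (lam ^+ t) lt1 => a ? ?; nra.
rewrite -(orbit_iter N p0 zp) wE /cycle_orbit.
have [m _ <-] := cycle_pt_in_orbit lk j.
by rewrite (@orbit_iter _ (4 * k.+1)) // -[X in iter X]mul1n cycle_period.
Qed.

End Dynamics.

Theorem corollary5p6 (R : realType) (lam : R) (hlam : 0 < lam < 1) :
  exists Gamma : nat -> set R[i],
    [/\ set_bij [set i | (1 <= i <= orbit_count lam)%N]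
                [set G | periodic_orbit lam G] Gamma,
        forall i, (1 <= i <= orbit_count lam)%N ->
          has_period lam (Gamma i) (4 * i)%N &
        forall z : R[i], nonsingular lam z ->
          exists2 i, (1 <= i <= orbit_count lam)%N &
            (fun n => dist_to (iter n (billiard lam) z) (Gamma i)) @ \oo
              --> (0 : R)].
Proof.
exists (fun i => cycle_orbit lam i.-1).
have thrE k : (k.+1 <= orbit_count lam)%N = (thr k.+1 lam < 0).
  exact: le_orbit_count.
have per i : (1 <= i <= orbit_count lam)%N ->
    has_period lam (cycle_orbit lam i.-1) (4 * i)%N.
  by case: i => // k; rewrite /= thrE; exact: cycle_orbit_period.
split=> //.
- split.
  + by move=> [|k] //=; rewrite thrE => /(cycle_orbit_periodic hlam).
  + move=> i j; rewrite !inE /= => /per hi /per hj e.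
    have [] := hi (cycle_pt lam 0 i.-1); first by exists 0%N.
    have := hj (cycle_pt lam 0 i.-1); rewrite -e => -[|]; first by exists 0%N.
    move=> j0 ej minj i0 ei mini.
    have [ij|ji|//] := ltngtP i j.
      by case: (minj (4 * i)%N); rewrite // i0 ltn_pmul2l.
    by case: (mini (4 * j)%N); rewrite // j0 ltn_pmul2l.
  + move=> G /(periodic_orbit_is_cycle hlam)[k lk ->].
    by exists k.+1; rewrite //= thrE.
- move=> z nz; have [k [N [j [lk sh]]]] := nonsingular_shadow hlam nz.
  by exists k.+1; [rewrite /= thrE|exact: (shadow_dist_cvg hlam lk sh)].
Qed.
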